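(* Let $(\Omega,\mathscr{H},\widehat{\mathbb E})$ be a sub-linear expectation space with conjugate expectation $\widehat{\mathcal E}$ and generated capacity $\mathbb V$. Suppose that $\mathscr{H}$ is a monotone class in the sense that $X\in\mathscr{H}$ whenever $\mathscr{H}\ni X_n\downarrow X\ge0$. Assume that $\widehat{\mathbb E}$ is continuous. Let $\{X_n;n\ge1\}$ be a sequence of independent and identically distributed random variables in $(\Omega,\mathscr{H},\widehat{\mathbb E})$ and $S_n=\sum_{k=1}^nX_k$. Then the following implications hold: (i) if $\mathbb V\big(\limsup_{n\to\infty}\frac{|S_n|}{n}=+\infty\big)<1$, then $C_{\mathbb V}[|X_1|]<\infty$; (ii) if $C_{\mathbb V}[|X_1|]<\infty$, then $$\mathbb V\Big(\Big\{\liminf_{n\to\infty}\frac{S_n}{n}<\widehat{\mathcal E}[X_1]\Big\}\cup\Big\{\limsup_{n\to\infty}\frac{S_n}{n}>\widehat{\mathbb E}[X_1]\Big\}\Big)=0.$$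
   Context: Let $(\Omega,\mathcal F)$ be a measurable space. $C_{l,Lip}(\mathbb R^n)$ is the linear space of functions $\varphi:\mathbb R^n\to\mathbb R$ such that $|\varphi(x)-\varphi(y)|\le C(1+|x|^m+|y|^m)|x-y|$ for all $x,y\in\mathbb R^n$, for some $C>0$, $m\in\mathbb N$ depending on $\varphi$. $\mathscr H$ is a linear space of real ($\mathcal F$-measurable) functions on $(\Omega,\mathcal F)$ (called random variables) such that $X_1,\ldots,X_n\in\mathscr H$ implies $\varphi(X_1,\ldots,X_n)\in\mathscr H$ for every $\varphi\in C_{l,Lip}(\mathbb R^n)$. A sub-linear expectation on $\mathscr H$ is a functional $\widehat{\mathbb E}:\mathscr H\to[-\infty,\infty]$ such that for all $X,Y\in\mathscr H$: (a) $X\ge Y$ implies $\widehat{\mathbb E}[X]\ge\widehat{\mathbb E}[Y]$; (b) $\widehat{\mathbb E}[c]=c$ for constants $c$; (c) $\widehat{\mathbb E}[X+Y]\le\widehat{\mathbb E}[X]+\widehat{\mathbb E}[Y]$ whenever the right side is not of the form $+\infty-\infty$ or $-\infty+\infty$; (d) $\widehat{\mathbb E}[\lambda X]=\lambda\widehat{\mathbb E}[X]$ for $\lambda\ge0$. The triple $(\Omega,\mathscr H,\widehat{\mathbb E})$ is called a sub-linear expectation space. The conjugate expectation is $\widehat{\mathcal E}[X]:=-\widehat{\mathbb E}[-X]$. A sub-linear expectation $\widehat{\mathbb E}:\mathscr H\to\mathbb R$ is called continuous if it is continuous from below ($\widehat{\mathbb E}[X_n]\uparrow\widehat{\mathbb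 E}[X]$ if $0\le X_n\uparrow X$, $X_n,X\in\mathscr H$) and continuous from above ($\widehat{\mathbb E}[X_n]\downarrow\widehat{\mathbb E}[X]$ if $0\le X_n\downarrow X$, $X_n,X\in\mathscr H$). Independence (not symmetric): a random vector $\mathbf Y=(Y_1,\ldots,Y_n)$, $Y_i\in\mathscr H$, is independent to $\mathbf X=(X_1,\ldots,X_m)$, $X_i\in\mathscr H$, if for each $\varphi\in C_{l,Lip}(\mathbb R^m\times\mathbb R^n)$ one has $\widehat{\mathbb E}[\varphi(\mathbf X,\mathbf Y)]=\widehat{\mathbb E}\big[\widehat{\mathbb E}[\varphi(\mathbf x,\mathbf Y)]\big|_{\mathbf x=\mathbf X}\big]$ whenever $\overline\varphi(\mathbf x):=\widehat{\mathbb E}[|\varphi(\mathbf x,\mathbf Y)|]<\infty$ for all $\mathbf x$ and $\widehat{\mathbb E}[|\overline\varphi(\mathbf X)|]<\infty$. A sequence $\{X_n;n\ge1\}$ in $\mathscr H$ is called independent if $X_{i+1}$ is independent to $(X_1,\ldots,X_i)$ for each $i\ge1$. It is identically distributed if for each $i\ge1$, $\widehat{\mathbb E}[\varphi(X_i)]=\widehat{\mathbb E}[\varphi(X_1)]$ for all $\varphi\in C_{l,Lip}(\mathbb R)$ whenever the sub-linear expectations are finite. The generated capacity is $\mathbb V(A):=\inf\{\widehat{\mathbb E}[\xi]: I_A\le\xi,\ \xi\in\mathscr H\}$, $A\in\mathcal F$. The Choquet integral is $C_{\mathbb V}[X]=\int_0^\infty\mathbb V(X\ge t)\,dt+\int_{-\infty}^0[\mathbb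 V(X\ge t)-1]\,dt$. *)

(* Defs.v *)
From HB Require Import structures.
From mathcomp Require Export all_boot all_order all_algebra.
From mathcomp Require Export all_classical all_reals all_analysis.
Import Order.TTheory GRing.Theory Num.Theory.
Import numFieldNormedType.Exports.

Set Implicit Arguments.
Unset Strict Implicit.
Unset Printing Implicit Defensive.

Local Open Scope classical_set_scope.
Local Open Scope ring_scope.
Local Open Scope ereal_scope.

(* The library norm on 'rV[R]_n is the sup norm. *)
Definition enorm (R : realType) (n : nat) (x : 'rV[R]_n) : R :=
  Num.sqrt (\sum_(i < n) x ord0 i ^+ 2)%R.

Definition C_l_Lip (R : realType) (n : nat) (phi : 'rV[R]_n -> R) : Prop :=
  exists (C : R) (m : nat), (0 < C)%R /\
    forall x y : 'rV[R]_n,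
      (`|phi x - phi y| <=
         C * (1 + enorm x ^+ m + enorm y ^+ m) * enorm (x - y))%R.

Definition rvec (R : realType) (T : Type) (n : nat) (X : 'I_n -> T -> R)
    (w : T) : 'rV[R]_n :=
  \row_(i < n) X i w.

Record rv_space (R : realType) (d : measure_display) (T : measurableType d)
    (H : set (T -> R)) : Prop := RvSpace {
  rv_measurable : forall X, H X -> measurable_fun [set: T] X ;
  rv_zero : H (fun=> 0%R) ;
  rv_linear : forall (a : R) (X Y : T -> R),
    H X -> H Y -> H (fun w => a * X w + Y w)%R ;
  rv_Lip : forall (n : nat) (X : 'I_n -> T -> R) (phi : 'rV[R]_n -> R),
    (forall i, H (X i)) -> C_l_Lip phi -> H (fun w => phi (rvec X w)) }.

(* A functional on H is represented by a function on all of T -> R whose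
   values outside H are irrelevant: it is only ever applied to members of H.
   [x +? y] says that x + y is not of the form oo - oo. *)
Record sublinear_expectation (R : realType) (T : Type)
    (H : set (T -> R)) (E : (T -> R) -> \bar R) : Prop := SublinearExpectation {
  sle_monotone : forall X Y : T -> R, H X -> H Y ->
    (forall w, (Y w <= X w)%R) -> E Y <= E X ;
  sle_cst : forall c : R, E (fun=> c) = c%:E ;
  sle_subadditive : forall X Y : T -> R, H X -> H Y ->
    E X +? E Y -> E (fun w => X w + Y w)%R <= E X + E Y ;
  sle_homogeneous : forall (l : R) (X : T -> R), (0 <= l)%R -> H X ->
    E (fun w => l * X w)%R = l%:E * E X }.

Definition conjugate_expectation (R : realType) (T : Type)
    (E : (T -> R) -> \bar R) (X : T -> R) : \bar R :=
  - E (fun w => - X w)%R.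

Definition pointwise_up (R : realType) (T : Type)
    (Xn : nat -> T -> R) (X : T -> R) : Prop :=
  forall w, nondecreasing_seq (Xn ^~ w) /\ Xn n w @[n --> \oo] --> X w.

Definition pointwise_down (R : realType) (T : Type)
    (Xn : nat -> T -> R) (X : T -> R) : Prop :=
  forall w, nonincreasing_seq (Xn ^~ w) /\ Xn n w @[n --> \oo] --> X w.

Definition continuous_from_below (R : realType) (T : Type)
    (H : set (T -> R)) (E : (T -> R) -> \bar R) : Prop :=
  forall (Xn : nat -> T -> R) (X : T -> R), (forall n, H (Xn n)) -> H X ->
    (forall n w, (0 <= Xn n w)%R) -> pointwise_up Xn X ->
    nondecreasing_seq (fun n => E (Xn n)) /\ E (Xn n) @[n --> \oo] --> E X.

Definition continuous_from_above (R : realType) (T : Type)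
    (H : set (T -> R)) (E : (T -> R) -> \bar R) : Prop :=
  forall (Xn : nat -> T -> R) (X : T -> R), (forall n, H (Xn n)) -> H X ->
    (forall n w, (0 <= Xn n w)%R) -> pointwise_down Xn X ->
    nonincreasing_seq (fun n => E (Xn n)) /\ E (Xn n) @[n --> \oo] --> E X.

(* Continuity is a property of real-valued sub-linear expectations.  (For a
   sub-linear expectation, finiteness on H also follows from continuity from
   above, applied to |X| / n.) *)
Definition continuous_expectation (R : realType) (T : Type)
    (H : set (T -> R)) (E : (T -> R) -> \bar R) : Prop :=
  [/\ forall X, H X -> E X \is a fin_num,
      continuous_from_below H E & continuous_from_above H E].

Definition monotone_class (R : realType) (T : Type) (H : set (T -> R)) : Prop :=
  forall (Xn : nat -> T -> R) (X : T -> R), (forall n, H (Xn n)) ->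
    pointwise_down Xn X -> (forall w, (0 <= X w)%R) -> H X.

(* Y is independent to X.  The two memberships in H say that the expectations
   of the functions obtained by substituting X for x are defined; they hold
   automatically when E is real-valued on H. *)
Definition independent_to (R : realType) (T : Type)
    (H : set (T -> R)) (E : (T -> R) -> \bar R) (m n : nat)
    (Y : 'I_n -> T -> R) (X : 'I_m -> T -> R) : Prop :=
  forall phi : 'rV[R]_(m + n) -> R, C_l_Lip phi ->
    let phibar x := E (fun w => `|phi (row_mx x (rvec Y w))|%R) in
    let psi x := E (fun w => phi (row_mx x (rvec Y w))) in
    (forall x : 'rV[R]_m, phibar x < +oo) ->
    H (fun w => fine (phibar (rvec X w))) ->
    E (fun w => `|fine (phibar (rvec X w))|%R) < +oo ->
    H (fun w => fine (psi (rvec X w))) ->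
    E (fun w => phi (row_mx (rvec X w) (rvec Y w))) =
    E (fun w => fine (psi (rvec X w))).

(* Sequences of random variables are indexed from 1; the term 0 is unused. *)
Definition independent_seq (R : realType) (T : Type)
    (H : set (T -> R)) (E : (T -> R) -> \bar R) (X : nat -> T -> R) : Prop :=
  forall i : nat, (1 <= i)%N ->
    independent_to H E (fun _ : 'I_1 => X i.+1) (fun j : 'I_i => X j.+1).

Definition identically_distributed (R : realType) (T : Type)
    (E : (T -> R) -> \bar R) (X : nat -> T -> R) : Prop :=
  forall i : nat, (1 <= i)%N -> forall phi : 'rV[R]_1 -> R, C_l_Lip phi ->
    let law (Z : T -> R) := E (fun w => phi (rvec (fun _ : 'I_1 => Z) w)) in
    law (X i) \is a fin_num -> law (X 1%N) \is a fin_num ->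
    law (X i) = law (X 1%N).

Definition capacity (R : realType) (T : Type)
    (H : set (T -> R)) (E : (T -> R) -> \bar R) (A : set T) : \bar R :=
  ereal_inf [set E xi | xi in
    [set xi : T -> R | H xi /\ forall w, (\1_A w <= xi w)%R]].

Definition choquet (R : realType) (T : Type) (V : set T -> \bar R)
    (X : T -> R) : \bar R :=
  \int[lebesgue_measure]_(t in `[0%R, +oo[) V [set w | (t <= X w)%R] +
  \int[lebesgue_measure]_(t in `]-oo, 0%R]) (V [set w | (t <= X w)%R] - 1).

Definition partial_sum (R : realType) (T : Type) (X : nat -> T -> R)
    (n : nat) (w : T) : R :=
  (\sum_(1 <= k < n.+1) X k w)%R.

(* Main.v *)
Require Import Defs.
From mathcomp Require Import measurable_realfun ring lra.
Import Order.TTheory GRing.Theory Num.Theory.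
Import numFieldNormedType.Exports.
Set Implicit Arguments.
Unset Strict Implicit.
Unset Printing Implicit Defensive.
Local Open Scope classical_set_scope.
Local Open Scope ring_scope.

(** The class of locally Lipschitz functions contains the polynomials, so [H]
    is stable under products, and [E] is finite on [H]: every member of [H] has
    finite moments of all orders.  This turns both implications into moment
    estimates.

    Finiteness of the Choquet integral is Chebyshev's inequality in the form
    [V(|X| >= t) <= E[1 + X^2] / (1 + t^2)], the right-hand side being
    integrable over the half-line ([choquet_lty]).

    For the law of large numbers it is enough to bound [limsup S_n / n] from
    above by [E[X_1]], because the same bound for [- X_n] is the lower half.
    Fix [c], put [mu = E[c X_1]] and let [D_n] be the sum of the first [n]
    variables [c X_k - mu] ([excess]).  Sub-linear expectations give only a
    one-sided control of centred variables, [E[b (c X_k - mu)] <= 0] for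
    [b >= 0]; this is why moments of the positive part are used.  Expanding
    [((s + y)^+)^4] around [s], the term of first order in [y] has the
    nonnegative coefficient [4 (s^+)^3], so independence makes its contribution
    nonpositive, and the remaining terms are of order [(s^+)^2] and [1].
    By induction [E[(D_n^+)^2] = O(n)] and [E[(D_n^+)^4] = O(n^2)]
    ([second_moment], [fourth_moment]).  Hence [V(D_n >= n eps) = O(1 / n^2)],
    which is summable.

    The Borel-Cantelli lemma and the stability of null sets under countable
    unions both come from [capacity_cover]: a countable sum truncated at [1] is
    the limit of its truncated partial sums, it belongs to [H] because [H] is
    a monotone class, and continuity from below bounds its expectation by the
    sum of the expectations. *)

(** * Locally Lipschitz functions of polynomial growth *)

Section locally_Lipschitz.
Context {R : realType}.

Lemma enorm_ge0 n (x : 'rV[R]_n) : 0 <= enorm x.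
Proof. exact: sqrtr_ge0. Qed.

Lemma enorm0 n : enorm (0 : 'rV[R]_n) = 0.
Proof.
rewrite /enorm big1 ?sqrtr0// => i _.
by rewrite mxE expr0n.
Qed.

Lemma coord_le_enorm n (x : 'rV[R]_n) i : `|x ord0 i| <= enorm x.
Proof.
rewrite -sqrtr_sqr ler_sqrt; last by apply: sumr_ge0 => j _; exact: sqr_ge0.
by rewrite (bigD1 i)//= lerDl; apply: sumr_ge0 => j _; exact: sqr_ge0.
Qed.

Lemma enorm_le_sum n (x : 'rV[R]_n) : enorm x <= \sum_i `|x ord0 i|.
Proof.
rewrite -[leRHS]ger0_norm ?sumr_ge0// -sqrtr_sqr ler_sqrt ?sqr_ge0//.
suff [] : 0 <= \sum_i `|x ord0 i| /\
  \sum_i x ord0 i ^+ 2 <= (\sum_i `|x ord0 i|) ^+ 2 by [].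
apply: (big_ind2 (fun a b : R => 0 <= b /\ a <= b ^+ 2)).
- by rewrite expr0n.
- by move=> a b c d [b0 ab] [d0 cd]; split; nra.
- by move=> i _; rewrite normr_ge0 real_normK ?num_real.
Qed.

Lemma sum_sqr_row_mx m n (x : 'rV[R]_m) (y : 'rV[R]_n) :
  \sum_i row_mx x y ord0 i ^+ 2 =
  \sum_i x ord0 i ^+ 2 + \sum_i y ord0 i ^+ 2.
Proof.
rewrite big_split_ord/=; congr +%R; apply: eq_bigr => i _.
  by rewrite row_mxEl.
by rewrite row_mxEr.
Qed.

Lemma enorm_row_mx m n (x : 'rV[R]_m) (y : 'rV[R]_n) :
  enorm (row_mx x y) <= enorm x + enorm y.
Proof.
have h k (z : 'rV[R]_k) : \sum_i z ord0 i ^+ 2 = enorm z ^+ 2.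
  by rewrite sqr_sqrtr// sumr_ge0// => i _; exact: sqr_ge0.
have ? := enorm_ge0 x; have ? := enorm_ge0 y.
rewrite {1}/enorm sum_sqr_row_mx !h -[leRHS]ger0_norm ?addr_ge0// -sqrtr_sqr.
by rewrite ler_sqrt ?sqr_ge0//; nra.
Qed.

Lemma enorm_row_mx_subl m n (x x' : 'rV[R]_m) (y : 'rV[R]_n) :
  enorm (row_mx x y - row_mx x' y) = enorm (x - x').
Proof.
rewrite opp_row_mx add_row_mx subrr /enorm sum_sqr_row_mx.
by rewrite [X in _ + X]big1 ?addr0// => i _; rewrite mxE expr0n.
Qed.

(** The product form makes powers of the growth factor multiply and compare
    directly, which the sum [1 + |x|^m + |y|^m] does not. *)
Definition weight n (x y : 'rV[R]_n) : R := (1 + enorm x) * (1 + enorm y).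

Lemma weight_ge1 n (x y : 'rV[R]_n) : 1 <= weight x y.
Proof.
by have ? := enorm_ge0 x; have ? := enorm_ge0 y; rewrite /weight; nra.
Qed.

(** From the sum to the product: each summand is at most [weight x y ^+ m].
    Conversely [(u v)^m <= u^(2m) + v^(2m)] for [u = 1 + |x|], [v = 1 + |y|],
    and [(1 + a)^k <= 2^k (1 + a^k)]. *)
Lemma C_l_LipP n (phi : 'rV[R]_n -> R) :
  C_l_Lip phi <-> exists C m, 0 <= C /\
    forall x y, `|phi x - phi y| <= C * weight x y ^+ m * enorm (x - y).
Proof.
split=> [[C [m [C0 phiC]]]|[C [m [C0 phiC]]]].
  exists (3 * C), m; split=> [|x y]; first by lra.
  apply: (le_trans (phiC x y)); apply: ler_wpM2r; first exact: enorm_ge0.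
  rewrite (mulrC 3) -mulrA; apply: ler_wpM2l; first exact: ltW.
  have a0 := enorm_ge0 x; have b0 := enorm_ge0 y.
  have w1 : 1 <= weight x y ^+ m by exact/exprn_ege1/weight_ge1.
  have wx : enorm x ^+ m <= weight x y ^+ m.
    by apply: lerXn2r; rewrite ?nnegrE /weight; nra.
  have wy : enorm y ^+ m <= weight x y ^+ m.
    by apply: lerXn2r; rewrite ?nnegrE /weight; nra.
  lra.
have pow_le k (a : R) : 0 <= a -> (1 + a) ^+ k <= 2 ^+ k * (1 + a ^+ k).
  move=> a0; have ak0 : 0 <= a ^+ k by exact: exprn_ge0.
  have k2 : 0 <= 2 ^+ k :> R by exact: exprn_ge0.
  have [a1|a1] := leP a 1.
    apply: (@le_trans _ _ (2 ^+ k)); last by nra.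
    by apply: lerXn2r; rewrite ?nnegrE; lra.
  apply: (@le_trans _ _ ((2 * a) ^+ k)); last by rewrite exprMn; nra.
  by apply: lerXn2r; rewrite ?nnegrE; lra.
exists ((C + 1) * 2 ^+ (m * 2).+1), (m * 2)%N; split=> [|x y].
  by apply: mulr_gt0; [lra|exact: exprn_gt0].
apply: (le_trans (phiC x y)); apply: ler_wpM2r; first exact: enorm_ge0.
have w0 : 0 <= weight x y ^+ m by apply/exprn_ge0/(le_trans ler01)/weight_ge1.
rewrite -[leRHS]mulrA; apply: ler_pM => //; first by lra.
have hx := pow_le (m * 2)%N _ (enorm_ge0 x).
have hy := pow_le (m * 2)%N _ (enorm_ge0 y).
have h2 : 0 <= 2 ^+ (m * 2) :> R by exact: exprn_ge0.
have px := exprn_ge0 (m * 2) (enorm_ge0 x).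
have py := exprn_ge0 (m * 2) (enorm_ge0 y).
rewrite [in leRHS]exprS /weight; move: hx hy.
move: (1 + enorm x) (1 + enorm y) => u v; rewrite exprMn (exprM u) (exprM v).
have : 0 <= (u ^+ m - v ^+ m) ^+ 2 by exact: sqr_ge0.
by move: (u ^+ m) (v ^+ m) => a b; nra.
Qed.

Lemma weight_exp_le n (x y : 'rV[R]_n) m k :
  (m <= k)%N -> weight x y ^+ m <= weight x y ^+ k.
Proof. by move=> mk; apply: ler_weXn2l => //; exact: weight_ge1. Qed.

Lemma C_l_Lip_cst n (c : R) : C_l_Lip (fun _ : 'rV[R]_n => c).
Proof.
exists 1, 0%N; split=> // x y; rewrite subrr normr0 mulr_ge0 ?enorm_ge0//.
by rewrite mul1r !expr0; lra.
Qed.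

Lemma C_l_Lip_coord n (i : 'I_n) : C_l_Lip (fun x : 'rV[R]_n => x ord0 i).
Proof.
exists 1, 0%N; split=> // x y; rewrite mul1r !expr0.
have := coord_le_enorm (x - y) i; rewrite !mxE => h; apply: (le_trans h).
by have := enorm_ge0 (x - y); lra.
Qed.

Lemma C_l_LipD n (f g : 'rV[R]_n -> R) :
  C_l_Lip f -> C_l_Lip g -> C_l_Lip (fun x => f x + g x).
Proof.
move=> /C_l_LipP[C [m [C0 fC]]] /C_l_LipP[D [k [D0 gD]]].
apply/C_l_LipP; exists (C + D), (m + k)%N; split=> [|x y].
  exact: addr_ge0.
rewrite opprD addrACA (le_trans (ler_normD _ _))// !mulrDl lerD//.
  apply: (le_trans (fC x y)); rewrite ler_wpM2r ?enorm_ge0// ler_wpM2l//.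
  exact/weight_exp_le/leq_addr.
apply: (le_trans (gD x y)); rewrite ler_wpM2r ?enorm_ge0// ler_wpM2l//.
exact/weight_exp_le/leq_addl.
Qed.

Lemma C_l_Lip_growth n (f : 'rV[R]_n -> R) : C_l_Lip f ->
  exists K m, 0 <= K /\ forall x, `|f x| <= K * (1 + enorm x) ^+ m.
Proof.
move=> /C_l_LipP[C [m [C0 fC]]]; exists (`|f 0| + C), m.+1.
split=> [|x]; first exact: addr_ge0.
have x0 := enorm_ge0 x.
have p1 k : 1 <= (1 + enorm x) ^+ k by apply: exprn_ege1; lra.
have := fC x 0; rewrite /weight enorm0 addr0 mulr1 subr0 => h.
have : `|f x| <= `|f 0| + `|f x - f 0|.
  by rewrite -{1}(subrK (f 0) (f x)) addrC ler_normD.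
have := p1 m; have := p1 m.+1; have := normr_ge0 (f 0).
rewrite exprS; set p := _ ^+ m in h *; nra.
Qed.

Lemma C_l_LipM n (f g : 'rV[R]_n -> R) :
  C_l_Lip f -> C_l_Lip g -> C_l_Lip (fun x => f x * g x).
Proof.
move=> fL gL.
have [K [p [K0 fK]]] := C_l_Lip_growth fL.
have [L [q [L0 gL']]] := C_l_Lip_growth gL.
move: fL gL => /C_l_LipP[C [m [C0 fC]]] /C_l_LipP[D [k [D0 gD]]].
apply/C_l_LipP; exists (K * D + L * C), (p + k + (q + m))%N.
split=> [|x y]; first by rewrite addr_ge0// mulr_ge0.
have x0 := enorm_ge0 x; have y0 := enorm_ge0 y.
rewrite (_ : f x * g x - f y * g y = f x * (g x - g y) + g y * (f x - f y));
  last by ring.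
rewrite (le_trans (ler_normD _ _))// !mulrDl lerD// normrM.
  apply: (@le_trans _ _ ((K * weight x y ^+ p) *
                         (D * weight x y ^+ k * enorm (x - y)))).
    apply: ler_pM => //; apply: (le_trans (fK x)); rewrite ler_wpM2l//.
    by apply: lerXn2r; rewrite ?nnegrE /weight; nra.
  rewrite mulrA ler_wpM2r ?enorm_ge0// mulrACA -exprD ler_wpM2l ?mulr_ge0//.
  exact/weight_exp_le/leq_addr.
apply: (@le_trans _ _ ((L * weight x y ^+ q) *
                       (C * weight x y ^+ m * enorm (x - y)))).
  apply: ler_pM => //; apply: (le_trans (gL' y)); rewrite ler_wpM2l//.
  by apply: lerXn2r; rewrite ?nnegrE /weight; nra.
rewrite mulrA ler_wpM2r ?enorm_ge0// mulrACA -exprD ler_wpM2l ?mulr_ge0//.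
exact/weight_exp_le/leq_addl.
Qed.

Lemma C_l_LipX n (f : 'rV[R]_n -> R) k :
  C_l_Lip f -> C_l_Lip (fun x => f x ^+ k).
Proof.
move=> fL; elim: k => [|k IH].
  by under [X in C_l_Lip X]funext do rewrite expr0; exact: C_l_Lip_cst.
under [X in C_l_Lip X]funext do rewrite exprS; exact: C_l_LipM.
Qed.

Lemma C_l_Lip_sum n I (r : seq I) (F : I -> 'rV[R]_n -> R) :
  (forall i, C_l_Lip (F i)) -> C_l_Lip (fun x => \sum_(i <- r) F i x).
Proof.
move=> FL; elim: r => [|i r IH].
  by under [X in C_l_Lip X]funext do rewrite big_nil; exact: C_l_Lip_cst.
under [X in C_l_Lip X]funext do rewrite big_cons; exact: C_l_LipD.
Qed.

Lemma C_l_Lip_norm n (f : 'rV[R]_n -> R) :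
  C_l_Lip f -> C_l_Lip (fun x => `|f x|).
Proof.
move=> [C [m [C0 fC]]]; exists C, m; split=> // x y.
exact: (le_trans (ler_dist_dist _ _)).
Qed.

Lemma C_l_Lip_pos n (f : 'rV[R]_n -> R) :
  C_l_Lip f -> C_l_Lip (fun x => Num.max (f x) 0).
Proof.
move=> [C [m [C0 fC]]]; exists C, m; split=> // x y.
apply: le_trans (fC x y); case: (leP (f x) 0); case: (leP (f y) 0) => *;
  by rewrite ler_norml; have := ler_norm (f x - f y);
    have := ler_norm (- (f x - f y)); rewrite normrN; lra.
Qed.

End locally_Lipschitz.

(** * Random variables and their finite expectations *)

Section rv_space_closure.
Context {R : realType} {d : measure_display} {Omega : measurableType d}.
Context {H : set (Omega -> R)} (H_space : rv_space H).
Implicit Types X Y : Omega -> R.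

(** A constant is a locally Lipschitz function of the empty family. *)
Lemma rv_cst (c : R) : H (fun=> c).
Proof.
exact: (rv_Lip H_space (X := fun i : 'I_0 => fun=> 0) (fun i => rv_zero H_space)
  (@C_l_Lip_cst R 0 c)).
Qed.

Lemma rv_comp1 (phi : 'rV[R]_1 -> R) X : C_l_Lip phi -> H X ->
  H (fun w => phi (rvec (fun=> X) w)).
Proof. by move=> phiL HX; apply: (rv_Lip H_space _ phiL). Qed.

Lemma rvecE n (X : 'I_n -> Omega -> R) w i : rvec X w ord0 i = X i w.
Proof. by rewrite mxE. Qed.

Lemma rvD X Y : H X -> H Y -> H (fun w => X w + Y w).
Proof.
move=> HX HY; have := rv_linear H_space 1 HX HY.
by under eq_fun do rewrite mul1r.
Qed.

Lemma rvZ c X : H X -> H (fun w => c * X w).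
Proof.
move=> HX; have := rv_linear H_space c HX (rv_zero H_space).
by under eq_fun do rewrite addr0.
Qed.

Lemma rvB X Y : H X -> H Y -> H (fun w => X w - Y w).
Proof.
move=> HX HY; have := rv_linear H_space (-1) HY HX.
by under eq_fun do rewrite mulN1r addrC.
Qed.

Lemma rvX k X : H X -> H (fun w => X w ^+ k).
Proof.
move=> HX; have := rv_comp1 (C_l_LipX k (C_l_Lip_coord ord0)) HX.
by under eq_fun do rewrite rvecE.
Qed.

Lemma rv_norm X : H X -> H (fun w => `|X w|).
Proof.
move=> HX; have := rv_comp1 (C_l_Lip_norm (C_l_Lip_coord ord0)) HX.
by under eq_fun do rewrite rvecE.
Qed.

Lemma rv_pos X : H X -> H (fun w => Num.max (X w) 0).
Proof.
move=> HX; have := rv_comp1 (C_l_Lip_pos (C_l_Lip_coord ord0)) HX.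
by under eq_fun do rewrite rvecE.
Qed.

Lemma rv_sum I (r : seq I) (F : I -> Omega -> R) :
  (forall i, H (F i)) -> H (fun w => \sum_(i <- r) F i w).
Proof.
move=> HF; elim: r => [|i r IH].
  by under eq_fun do rewrite big_nil; exact: rv_cst.
by under eq_fun do rewrite big_cons; exact: rvD.
Qed.

(** Freezing some coordinates amounts to replacing them by constant random
    variables. *)
Lemma rv_row_mx m n (phi : 'rV[R]_(m + n) -> R) (x : 'rV[R]_m)
    (Y : 'I_n -> Omega -> R) : C_l_Lip phi -> (forall i, H (Y i)) ->
  H (fun w => phi (row_mx x (rvec Y w))).
Proof.
move=> phiL HY.
pose Z (i : 'I_(m + n)) w := row_mx x (rvec Y w) ord0 i.
have HZ i : H (Z i).
  rewrite /Z; case: (splitP i) => j ij.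
    have -> : i = lshift n j by apply: val_inj.
    by under eq_fun do rewrite row_mxEl; exact: rv_cst.
  have -> : i = rshift m j by apply: val_inj.
  by under eq_fun do rewrite row_mxEr rvecE; exact: HY.
have := rv_Lip H_space HZ phiL.
suff -> : rvec Z = fun w => row_mx x (rvec Y w) by [].
by apply/funext => w; apply/rowP => i; rewrite mxE.
Qed.

End rv_space_closure.

Section real_expectation.
Context {R : realType} {d : measure_display} {Omega : measurableType d}.
Context {H : set (Omega -> R)} {E : (Omega -> R) -> \bar R}.
Hypothesis H_space : rv_space H.
Hypothesis E_sublinear : sublinear_expectation H E.
Hypothesis E_fin : forall X, H X -> E X \is a fin_num.
Implicit Types X Y Z : Omega -> R.

Local Notation e X := (fine (E X)).

Lemma E_fine X : H X -> E X = (e X)%:E.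
Proof. by move=> HX; rewrite fineK// E_fin. Qed.

Lemma e_le X Y : H X -> H Y -> (forall w, X w <= Y w) -> e X <= e Y.
Proof.
move=> HX HY XY; have := sle_monotone E_sublinear HY HX XY.
by rewrite (E_fine HX) (E_fine HY).
Qed.

Lemma e_cst (c : R) : e (fun=> c) = c.
Proof. by rewrite (sle_cst E_sublinear). Qed.

Lemma eD X Y : H X -> H Y -> e (fun w => X w + Y w) <= e X + e Y.
Proof.
move=> HX HY; have HXY := rvD H_space HX HY.
have := sle_subadditive E_sublinear HX HY.
by rewrite (E_fine HX) (E_fine HY) (E_fine HXY) => /(_ isT).
Qed.

Lemma eZ c X : 0 <= c -> H X -> e (fun w => c * X w) = c * e X.
Proof.
by move=> c0 HX; rewrite (sle_homogeneous E_sublinear c0 HX) (E_fine HX).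
Qed.

Lemma e_leDZ X Y Z c : H X -> H Y -> H Z -> 0 <= c ->
  (forall w, X w <= Y w + c * Z w) -> e X <= e Y + c * e Z.
Proof.
move=> HX HY HZ c0 XYZ; have HcZ := rvZ H_space c HZ.
by rewrite -eZ//; apply: le_trans (eD HY HcZ); apply: e_le => //; exact: rvD.
Qed.

(** Write [rho = 1 + sum_i |Y_i|].  The growth factor at [(x, Y)], [(x', Y)] is
    at most [weight x x' * rho^2], so the increment of [phi] is dominated by
    [C * weight x x' ^ k * |x - x'|] times [rho^(2k)], a random variable of
    finite expectation. *)
Lemma expectation_C_l_Lip m n (phi : 'rV[R]_(m + n) -> R)
    (Y : 'I_n -> Omega -> R) : C_l_Lip phi -> (forall i, H (Y i)) ->
  C_l_Lip (fun x : 'rV[R]_m => e (fun w => phi (row_mx x (rvec Y w)))).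
Proof.
move=> phiL HY; have [C [k [C0 phiC]]] := (C_l_LipP phi).1 phiL.
pose rho w := 1 + \sum_i `|Y i w|.
have rho1 w : 1 <= rho w by rewrite lerDl sumr_ge0.
pose M w := rho w ^+ (k * 2).
have HM : H M.
  apply: rvX => //; apply: rvD => //; first exact: rv_cst.
  by apply: rv_sum => // i; exact: rv_norm.
have eM0 : 0 <= e M.
  rewrite -(e_cst 0); apply: e_le => // [|w]; first exact: rv_cst.
  by rewrite exprn_ge0// (le_trans ler01).
apply/C_l_LipP; exists (C * e M), k; split=> [|x x']; first exact: mulr_ge0.
pose b := C * weight x x' ^+ k * enorm (x - x').
have b0 : 0 <= b.
  by rewrite !mulr_ge0 ?enorm_ge0// exprn_ge0// (le_trans ler01)// weight_ge1.
have phib w : `|phi (row_mx x (rvec Y w)) - phi (row_mx x' (rvec Y w))| <=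
    b * M w.
  apply: (le_trans (phiC _ _)); rewrite enorm_row_mx_subl /b.
  rewrite [leRHS]mulrAC ler_wpM2r ?enorm_ge0// -mulrA ler_wpM2l//.
  rewrite /M mulnC exprM -exprMn; apply: lerXn2r;
    rewrite ?nnegrE ?(le_trans ler01 (weight_ge1 _ _))//.
    by rewrite mulr_ge0 ?sqr_ge0// (le_trans ler01)// weight_ge1.
  have hY : enorm (rvec Y w) <= rho w - 1.
    rewrite /rho addrC addKr; apply: (le_trans (enorm_le_sum _)).
    by apply: ler_sum => i _; rewrite rvecE.
  have := enorm_row_mx x (rvec Y w); have := enorm_row_mx x' (rvec Y w).
  have := enorm_ge0 x; have := enorm_ge0 x'; have := rho1 w.
  have := enorm_ge0 (row_mx x (rvec Y w)).
  have := enorm_ge0 (row_mx x' (rvec Y w)).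
  rewrite /weight => *; rewrite expr2 mulrACA.
  by apply: ler_pM; nra.
rewrite ler_distlC.
have -> : C * e M * weight x x' ^+ k * enorm (x - x') = b * e M.
  by rewrite /b; ring.
have HP z : H (fun w => phi (row_mx z (rvec Y w))).
  exact: (rv_row_mx H_space z phiL HY).
apply/andP; split; rewrite ?lerBlDr.
  apply: (e_leDZ (HP x) (HP x') HM b0) => w.
  by have := phib w; rewrite ler_norml => /andP[]; lra.
apply: (e_leDZ (HP x') (HP x) HM b0) => w.
by have := phib w; rewrite ler_norml => /andP[]; lra.
Qed.

(** The usable form of independence: a bound on the expectation with the past
    frozen can be integrated over the past.  The integrability conditions of
    [independent_to] hold because freezing the past yields locally Lipschitz
    functions and [E] is finite on [H]. *)
Lemma indep_le m n (Y : 'I_n -> Omega -> R) (X : 'I_m -> Omega -> R)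
    (phi : 'rV[R]_(m + n) -> R) (chi : 'rV[R]_m -> R) :
  independent_to H E Y X -> (forall i, H (X i)) -> (forall i, H (Y i)) ->
  C_l_Lip phi -> H (fun w => chi (rvec X w)) ->
  (forall x, e (fun w => phi (row_mx x (rvec Y w))) <= chi x) ->
  e (fun w => phi (row_mx (rvec X w) (rvec Y w))) <=
  e (fun w => chi (rvec X w)).
Proof.
move=> indep HX HY phiL Hchi phichi.
have Hbar := rv_Lip H_space HX (expectation_C_l_Lip (C_l_Lip_norm phiL) HY).
have Hpsi := rv_Lip H_space HX (expectation_C_l_Lip phiL HY).
rewrite indep//.
- by apply: e_le.
- move=> x; rewrite ltey_eq E_fin//.
  exact: (rv_row_mx H_space x (C_l_Lip_norm phiL) HY).
- by rewrite ltey_eq E_fin//; exact: rv_norm.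
Qed.

End real_expectation.

(** * Moments of the positive part of centred sums *)

Lemma pos_sqr_step (R : realFieldType) (s y : R) :
  Num.max (s + y) 0 ^+ 2 <=
  Num.max s 0 ^+ 2 + 2 * Num.max s 0 * y + y ^+ 2.
Proof. by case: (leP s 0) => s0; case: (leP (s + y) 0) => sy0; nra. Qed.

(** For [s >= 0] the right-hand side exceeds [(s + y)^4] by
    [2 y^2 (s - y)^2]; for [s < 0] it is [3 y^4], and [(s + y)^+ <= y^+]. *)
Lemma pos_quartic_step (R : realFieldType) (s y : R) :
  Num.max (s + y) 0 ^+ 4 <=
  Num.max s 0 ^+ 4 + 4 * Num.max s 0 ^+ 3 * y + 8 * Num.max s 0 ^+ 2 * y ^+ 2 +
  3 * y ^+ 4.
Proof.
case: (leP s 0) => s0; rewrite ?expr0n/= ?mulr0 ?mul0r ?add0r.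
  have y4 : 0 <= y ^+ 4 by rewrite exprn_even_ge0.
  case: (leP (s + y) 0) => sy0; first by rewrite expr0n/=; lra.
  apply: (@le_trans _ _ (y ^+ 4)); last by lra.
  by apply: lerXn2r; rewrite ?nnegrE; lra.
rewrite -subr_ge0.
have sq : 0 <= 2 * (y * (s - y)) ^+ 2 by rewrite mulr_ge0// sqr_ge0.
rewrite (_ : _ - _ = (s + y) ^+ 4 - Num.max (s + y) 0 ^+ 4 +
                     2 * (y * (s - y)) ^+ 2); last by ring.
apply: addr_ge0 => //; case: (leP (s + y) 0) => _; last by rewrite subrr.
by rewrite expr0n/= subr0 exprn_even_ge0.
Qed.

Section moments.
Context {R : realType} {d : measure_display} {Omega : measurableType d}.
Context {H : set (Omega -> R)} {E : (Omega -> R) -> \bar R}.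
Context {X : nat -> Omega -> R}.
Hypothesis H_space : rv_space H.
Hypothesis E_sublinear : sublinear_expectation H E.
Hypothesis E_fin : forall Z, H Z -> E Z \is a fin_num.
Hypothesis X_in_H : forall n, (1 <= n)%N -> H (X n).
Hypothesis X_independent : independent_seq H E X.
Hypothesis X_identical : identically_distributed E X.
Variable c : R.

Local Notation e Z := (fine (E Z)).

Let mu : R := e (fun w => c * X 1%N w).
Let Y k w := c * X k w - mu.

Definition excess n w : R := \sum_(i < n) Y i.+1 w.

Lemma excessE n w : excess n w = c * partial_sum X n w - n%:R * mu.
Proof.
rewrite /excess /partial_sum big_add1/= big_mkord sumrB mulr_sumr.
by rewrite sumr_const card_ord mulr_natl.
Qed.

Lemma excessS n w : excess n.+1 w = excess n w + Y n.+1 w.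
Proof. by rewrite /excess big_ord_recr. Qed.

Lemma H_Y k : H (Y k.+1).
Proof.
by apply: rvB => //; [apply: rvZ => //; exact: X_in_H|exact: rv_cst].
Qed.

Lemma H_excess n : H (excess n).
Proof. by apply: rv_sum => // i; exact: H_Y. Qed.

Lemma H_pos_excess n p : H (fun w => Num.max (excess n w) 0 ^+ p).
Proof. by apply: rvX => //; apply: rv_pos => //; exact: H_excess. Qed.

Lemma H_pos_shift s k p : H (fun w => Num.max (s + Y k.+1 w) 0 ^+ p).
Proof.
have HsY := rvD H_space (rv_cst H_space s) (H_Y k).
exact: (rvX H_space p (rv_pos H_space HsY)).
Qed.

(** All expectations involved are finite, so identical distribution applies to
    every locally Lipschitz [h]. *)
Lemma identical_e k (h : 'rV[R]_1 -> R) : C_l_Lip h ->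
  e (fun w => h (rvec (fun=> X k.+1) w)) =
  e (fun w => h (rvec (fun=> X 1%N) w)).
Proof.
move=> hL; congr fine.
have Hh j : H (fun w => h (rvec (fun=> X j.+1) w)).
  exact: (rv_comp1 H_space hL (X_in_H (ltn0Sn j))).
exact: (X_identical (ltn0Sn k) hL (E_fin (Hh k)) (E_fin (Hh 0%N))).
Qed.

Lemma e_Y_pow k p : e (fun w => Y k.+1 w ^+ p) = e (fun w => Y 1%N w ^+ p).
Proof.
have hL : C_l_Lip (fun v : 'rV[R]_1 => (c * v ord0 ord0 + (- mu)) ^+ p).
  apply/C_l_LipX/C_l_LipD/C_l_Lip_cst/C_l_LipM/C_l_Lip_coord.
  exact: C_l_Lip_cst.
have := identical_e k hL.
by under eq_fun do rewrite mxE; under [in RHS]eq_fun do rewrite mxE.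
Qed.

(** Sub-additivity splits off the constant: [E[c X_1 - mu] <= mu - mu]. *)
Lemma e_Y_le0 k : e (Y k.+1) <= 0.
Proof.
have -> : e (Y k.+1) = e (Y 1%N) by have := e_Y_pow k 1.
have HcX : H (fun w => c * X 1%N w) by apply: rvZ => //; exact: X_in_H.
have := eD H_space E_sublinear E_fin HcX (rv_cst H_space (- mu)).
by rewrite (e_cst E_sublinear) subrr.
Qed.

Let B2 := e (fun w => Y 1%N w ^+ 2).
Let B4 := e (fun w => Y 1%N w ^+ 4).

Lemma e_Y_pow_even_ge0 p : ~~ odd p -> 0 <= e (fun w => Y 1%N w ^+ p).
Proof.
move=> podd; rewrite -(e_cst E_sublinear 0).
apply: (e_le E_sublinear E_fin) => [||w]; first exact: rv_cst.
  by apply: rvX => //; exact: H_Y.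
by rewrite exprn_even_ge0.
Qed.

(** The linear term disappears because its coefficient is nonnegative and
    [E[Y_k] <= 0]; there is no third-order term, whose sign is uncontrolled. *)
Lemma e_le_quartic k Z a b q r : H Z -> 0 <= b -> 0 <= q -> 0 <= r ->
  (forall w, Z w <= a + b * Y k.+1 w + q * Y k.+1 w ^+ 2 + r * Y k.+1 w ^+ 4) ->
  e Z <= a + q * B2 + r * B4.
Proof.
move=> HZ b0 q0 r0 ZY; have HY := H_Y k.
have Ha := rv_cst H_space a; have HY2 := rvX H_space 2 HY.
have HY4 := rvX H_space 4 HY.
have H1 := rvD H_space Ha (rvZ H_space b HY).
have H2 := rvD H_space H1 (rvZ H_space q HY2).
rewrite /B2 /B4 -(e_Y_pow k 2) -(e_Y_pow k 4).
apply: (le_trans (e_leDZ H_space E_sublinear E_fin HZ H2 HY4 r0 ZY)).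
rewrite lerD2r.
apply: (le_trans (e_leDZ H_space E_sublinear E_fin H2 H1 HY2 q0 _)) => //.
rewrite lerD2r.
apply: (le_trans (e_leDZ H_space E_sublinear E_fin H1 Ha HY b0 _)) => //.
rewrite (e_cst E_sublinear); have := e_Y_le0 k; nra.
Qed.

(** One step of the recursion over [n]: [X_(n+1)] is independent of
    [(X_1, ..., X_n)] and [excess n] is an affine function of that past. *)
Lemma moment_step p n (g : R -> R) : H (fun w => g (excess n w)) ->
  (forall s, e (fun w => Num.max (s + Y n.+1 w) 0 ^+ p) <= g s) ->
  e (fun w => Num.max (excess n.+1 w) 0 ^+ p) <= e (fun w => g (excess n w)).
Proof.
move=> Hg stepg.
(* Independence concerns [n >= 1] only; [excess 0] is the constant 0, so
   [g (excess 0)] is its own expectation. *)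
case: n => [|n] in Hg stepg *.
  have := stepg 0.
  have -> : (fun w => g (excess 0 w)) = fun=> g 0.
    by apply/funext => w; rewrite /excess big_ord0.
  rewrite (e_cst E_sublinear).
  by under [in X in _ -> X]eq_fun do rewrite excessS {1}/excess big_ord0.
pose L m (v : 'rV[R]_m) := \sum_i (c * v ord0 i + - mu).
have LL m : C_l_Lip (@L m).
  apply: C_l_Lip_sum => i; apply/C_l_LipD/C_l_Lip_cst/C_l_LipM/C_l_Lip_coord.
  exact: C_l_Lip_cst.
pose X' (j : 'I_n.+1) := X j.+1.
have L_excess w : L _ (rvec X' w) = excess n.+1 w.
  by apply: eq_bigr => i _; rewrite mxE.
have L_row (v : 'rV[R]_n.+1) w :
    L _ (row_mx v (rvec (fun _ : 'I_1 => X n.+2) w)) = L _ v + Y n.+2 w.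
  rewrite /L big_split_ord/=; congr +%R.
    by apply: eq_bigr => i _; rewrite row_mxEl.
  by rewrite big_ord1 row_mxEr mxE.
pose X'' (_ : 'I_1) := X n.+2.
pose phi (v : 'rV[R]_(n.+1 + 1)) := Num.max (L _ v) 0 ^+ p.
have -> : (fun w => Num.max (excess n.+2 w) 0 ^+ p) =
          fun w => phi (row_mx (rvec X' w) (rvec X'' w)).
  by apply/funext => w; rewrite /phi L_row L_excess -excessS.
have gE : (fun w => g (excess n.+1 w)) = fun w => g (L _ (rvec X' w)).
  by apply/funext => w; rewrite L_excess.
have phiL : C_l_Lip phi by apply: C_l_LipX; exact: C_l_Lip_pos.
rewrite gE in Hg *.
apply: (indep_le H_space E_sublinear E_fin (X_independent (ltn0Sn n)) _ _ phiL
  (chi := g \o @L n.+1)) => // [i|i|v]; [exact: X_in_H|exact: X_in_H|].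
by under eq_fun do rewrite /phi L_row; exact: stepg.
Qed.

Lemma second_moment n : e (fun w => Num.max (excess n w) 0 ^+ 2) <= n%:R * B2.
Proof.
elim: n => [|n IH].
  under eq_fun do rewrite /excess big_ord0 maxxx expr0n/=.
  by rewrite (e_cst E_sublinear) mul0r.
have HP : H (fun w => Num.max (excess n w) 0 ^+ 2) by exact: H_pos_excess.
apply: (le_trans (@moment_step 2 n (fun s => Num.max s 0 ^+ 2 + B2) _ _)).
- exact: (rvD H_space HP (rv_cst H_space B2)).
- move=> s; have s0 : 0 <= 2 * Num.max s 0.
    by rewrite mulr_ge0// le_max lexx orbT.
  have := e_le_quartic (H_pos_shift s n 2) s0 ler01 (lexx 0).
  move=> /(_ n (Num.max s 0 ^+ 2)); rewrite mul1r mul0r addr0; apply=> w.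
  by rewrite mul0r addr0 mul1r pos_sqr_step.
apply: (le_trans (eD H_space E_sublinear E_fin HP (rv_cst H_space B2))).
by rewrite (e_cst E_sublinear) -natr1 mulrDl mul1r lerD2r.
Qed.

(** With [M_n] the fourth moment, [pos_quartic_step] and [second_moment] give
    [M_(n+1) <= M_n + 8 n B2^2 + 3 B4], whence the constant
    [K = 8 B2^2 + 3 B4]. *)
Lemma fourth_moment : exists K, forall n,
  e (fun w => Num.max (excess n w) 0 ^+ 4) <= K * n%:R ^+ 2.
Proof.
exists (8 * B2 ^+ 2 + 3 * B4); elim=> [|n IH].
  under eq_fun do rewrite /excess big_ord0 maxxx expr0n/=.
  by rewrite (e_cst E_sublinear) expr0n mulr0.
have B20 : 0 <= B2 by exact: e_Y_pow_even_ge0.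
have B40 : 0 <= B4 by exact: e_Y_pow_even_ge0.
have HP2 := H_pos_excess n 2; have HP4 := H_pos_excess n 4.
have H1 := rvD H_space HP4 (rv_cst H_space (3 * B4)).
have H2 := rvD H_space H1 (rvZ H_space (8 * B2) HP2).
apply: (le_trans (@moment_step 4 n (fun s => Num.max s 0 ^+ 4 + 3 * B4 +
  8 * B2 * Num.max s 0 ^+ 2) H2 _)).
  move=> s; rewrite -addrA (addrC (3 * B4)) addrA (mulrAC 8).
  have s0 : 0 <= Num.max s 0 by rewrite le_max lexx orbT.
  apply: (@e_le_quartic n _ _ (4 * Num.max s 0 ^+ 3)) => // [|||w].
  - exact: H_pos_shift.
  - by rewrite mulr_ge0// exprn_ge0.
  - by rewrite mulr_ge0// exprn_ge0.
  - exact: pos_quartic_step.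
have B80 : 0 <= 8 * B2 by rewrite mulr_ge0.
apply: (le_trans (e_leDZ H_space E_sublinear E_fin H2 H1 HP2 B80 _)) => //.
have := eD H_space E_sublinear E_fin HP4 (rv_cst H_space (3 * B4)).
rewrite (e_cst E_sublinear) => h1.
have h2 : 8 * B2 * e (fun w => Num.max (excess n w) 0 ^+ 2) <=
    8 * B2 * (n%:R * B2) by rewrite ler_wpM2l// second_moment.
have n0 : 0 <= n%:R :> R by [].
have := mulr_ge0 n0 B40; have := mulr_ge0 n0 (sqr_ge0 B2).
have := sqr_ge0 B2; rewrite -[n.+1%:R]natr1; nra.
Qed.

End moments.

(** * The generated capacity *)

Section capacity.
Context {R : realType} {d : measure_display} {Omega : measurableType d}.
Context {H : set (Omega -> R)} {E : (Omega -> R) -> \bar R}.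
Hypothesis H_space : rv_space H.
Hypothesis E_sublinear : sublinear_expectation H E.
Hypothesis E_fin : forall Z, H Z -> E Z \is a fin_num.

Local Notation e Z := (fine (E Z)).
Local Notation V := (capacity H E).

Lemma capacity_le (A : set Omega) xi : H xi -> (forall w, 0 <= xi w) ->
  (forall w, A w -> 1 <= xi w) -> (V A <= (e xi)%:E)%E.
Proof.
move=> Hxi xi0 xi1; apply: ereal_inf_lbound.
exists xi; last exact: (E_fine E_fin Hxi).
split=> // w; rewrite indicE; have [/set_mem/xi1//|_] := boolP (w \in A).
exact: xi0.
Qed.

Lemma capacity_ge0 A : (0 <= V A)%E.
Proof.
apply: le_ereal_inf_tmp => _ [xi [Hxi xiA] <-].
rewrite -[leLHS]/((0 : R)%:E) -(sle_cst E_sublinear).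
apply: (sle_monotone E_sublinear) => //.
  exact: rv_cst.
by move=> w; apply: le_trans (xiA w); rewrite indicE.
Qed.

Lemma capacity_mono A B : A `<=` B -> (V A <= V B)%E.
Proof.
move=> AB; apply: ereal_inf_le_tmp => _ [xi [Hxi xiB] <-].
exists xi => //; split=> // w; apply: le_trans (xiB w).
rewrite !indicE ler_nat; have [/set_mem/AB/mem_set->//|_] := boolP (w \in A).
by [].
Qed.

Lemma capacity_setT : V setT = 1%E.
Proof.
apply/eqP; rewrite eq_le; apply/andP; split.
  have := @capacity_le setT (fun=> 1) (rv_cst H_space 1) (fun=> ler01).
  by rewrite (e_cst E_sublinear); apply.
apply: le_ereal_inf_tmp => _ [xi [Hxi xiA] <-].
rewrite -[leLHS]/((1 : R)%:E) -(sle_cst E_sublinear).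
apply: (sle_monotone E_sublinear) => //.
  exact: rv_cst.
by move=> w; apply: le_trans (xiA w); rewrite indicE in_setT.
Qed.

(** Chebyshev with [1 + X^2] in place of [X^2], so that the bound is the
    derivative of the arctangent and needs no cut-off near [0].  On the negative
    half-line the integrand vanishes, the capacity of the whole space being
    [1]. *)
Lemma choquet_lty X : H X -> (choquet V (fun w => `|X w|)%R < +oo)%E.
Proof.
move=> HX; pose M w := 1 + X w ^+ 2.
have HM : H M by apply: rvD => //; [exact: rv_cst|exact: rvX].
pose F (t : R) := V [set w | (t <= `|X w|)%R].
have F_le1 t : (F t <= 1)%E by rewrite -capacity_setT; exact: capacity_mono.
have F_ge0 t : (0 <= F t)%E by exact: capacity_ge0.
have F_fin t : F t \is a fin_num.
  by rewrite ge0_fin_numE// (le_lt_trans (F_le1 t))// ltry.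
have F_le t : 0 <= t -> (F t <= (e M * (oneDsqr t)^-1)%:E)%E.
  move=> t0; have c0 : 0 <= (oneDsqr t)^-1 by rewrite invr_ge0 ltW ?oneDsqr_gt0.
  rewrite mulrC -(eZ E_sublinear E_fin c0 HM).
  apply: capacity_le; first exact: rvZ.
    by move=> w; rewrite mulr_ge0// addr_ge0// sqr_ge0.
  move=> w /= tX; rewrite mulrC ler_pdivlMr ?oneDsqr_gt0// mul1r.
  by rewrite /M /oneDsqr lerD2l -(real_normK (num_real (X w))) lerXn2r ?nnegrE.
rewrite /choquet [X in (_ + X)%E]integral0_eq ?adde0; last first.
  move=> t; rewrite /= in_itv/= => t0.
  rewrite [X in V X](_ : _ = setT) ?capacity_setT ?subee//.
  by apply/seteqP; split=> // w _ /=; exact: le_trans t0 _.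
apply: (@le_lt_trans _ _ (\int[lebesgue_measure]_(t in `[0%R, +oo[)
    ((e M)%:E * ((oneDsqr t)^-1)%:E)))%E.
  apply: ge0_le_integral => //.
  - by move=> t _; exact: F_ge0.
  - rewrite (_ : (fun t => _) = EFin \o (fine \o F)); last first.
      by apply/funext => t /=; rewrite fineK.
    apply/measurable_EFinP; apply: nonincreasing_measurable => // s t st.
    by rewrite /= fine_le//; apply: capacity_mono => w /=; exact: le_trans.
  - apply/measurable_EFinP; apply: measurable_funTS.
    apply: continuous_measurable_fun => t.
    by apply: cvgM; [exact: cvg_cst|exact: continuous_oneDsqrV].
  - by move=> t; rewrite /= in_itv/= andbT; exact: F_le.
rewrite ge0_integralZl//.
- by rewrite integral0y_oneDsqr -EFinM ltry.
- apply/measurable_EFinP; apply: measurable_funTS.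
  by apply: continuous_measurable_fun; exact: continuous_oneDsqrV.
- rewrite lee_fin -(e_cst E_sublinear 0); apply: (e_le E_sublinear E_fin) => //.
    exact: rv_cst.
  by move=> w; rewrite addr_ge0// sqr_ge0.
Qed.

Section continuity.
Hypothesis H_monotone : monotone_class H.
Hypothesis E_below : continuous_from_below H E.

(** Countable sub-additivity in functional form.  The sum of the [xi k] may
    diverge and need not lie in [H]; truncated at [1] it still dominates the
    indicator of [A], and one minus it is a decreasing limit of members of
    [H]. *)
Lemma capacity_cover (xi : nat -> Omega -> R) b (A : set Omega) :
  (forall k, H (xi k)) -> (forall k w, 0 <= xi k w) ->
  (forall n, \sum_(k < n) e (xi k) <= b) ->
  (forall w, A w -> exists k, 1 <= xi k w) -> (V A <= b%:E)%E.
Proof.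
move=> Hxi xi0 sumb coverA.
pose s n w := \sum_(k < n) xi k w.
pose eta n w := Num.min (s n w) 1.
have Hs n : H (s n) by apply: rv_sum.
have es n : e (s n) <= b.
  apply: le_trans (sumb n); elim: n => [|n IH].
    rewrite big_ord0 /s; under eq_fun do rewrite big_ord0.
    by rewrite (e_cst E_sublinear).
  rewrite big_ord_recr/= /s; under eq_fun do rewrite big_ord_recr/=.
  apply: (le_trans (eD H_space E_sublinear E_fin (Hs n) (Hxi n))).
  by rewrite lerD2r.
have coeta n w : 1 - eta n w = Num.max (1 - s n w) 0.
  by rewrite /eta; case: (leP (s n w) 1); case: (leP (1 - s n w) 0); lra.
have Hco n : H (fun w => 1 - eta n w).
  under eq_fun do rewrite coeta.
  by apply: rv_pos => //; apply: rvB => //; exact: rv_cst.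
have Heta n : H (eta n).
  have := rvB H_space (rv_cst H_space 1) (Hco n).
  by under eq_fun do rewrite opprB addrC subrK.
have eta0 n w : 0 <= eta n w by rewrite le_min ler01 andbT sumr_ge0.
have eta1 n w : eta n w <= 1 by rewrite ge_min lexx orbT.
have eta_nd w : nondecreasing_seq (eta ^~ w).
  apply/nondecreasing_seqP => n; rewrite /eta le_min !ge_min lexx orbT andbT.
  by rewrite /s big_ord_recr/= lerDl xi0.
have eta_cvg w : cvgn (eta ^~ w).
  apply: nondecreasing_is_cvgn => //; exists 1 => _ [n _ <-]; exact: eta1.
pose etay w := limn (eta ^~ w).
have etaE w n : eta n w <= etay w by exact: nondecreasing_cvgn_le.
have etay1 w : etay w <= 1 by apply: limr_le => //; exact: nearW.
have Hetay : H etay.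
  suff Hc : H (fun w => 1 - etay w).
    have := rvB H_space (rv_cst H_space 1) Hc.
    by under eq_fun do rewrite opprB addrC subrK.
  apply: (H_monotone Hco) => w; last by rewrite subr_ge0.
  split; first by move=> m n mn; rewrite lerD2l lerN2; exact: eta_nd.
  by apply: cvgB => //; exact: cvg_cst.
have [_ cvgE] := E_below Heta Hetay eta0 (fun w => conj (eta_nd w) (eta_cvg w)).
have eb : (E etay <= b%:E)%E.
  rewrite -(cvg_lim _ cvgE)//; apply: lime_le.
    by apply/cvg_ex; exists (E etay).
  apply: nearW => n; rewrite (E_fine E_fin (Heta n)) lee_fin.
  apply: le_trans (es n).
  by apply: (e_le E_sublinear E_fin) => // w; rewrite ge_min lexx.
apply: le_trans eb; rewrite (E_fine E_fin Hetay); apply: capacity_le => //.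
  by move=> w; apply: le_trans (etaE w 0%N).
move=> w /coverA[k xik]; apply: le_trans (etaE w k.+1).
rewrite le_min lexx andbT (le_trans xik)// /s big_ord_recr/= lerDr.
by rewrite sumr_ge0.
Qed.

Lemma capacity_bigcup_null (A : nat -> set Omega) :
  (forall j, V (A j) = 0%E) -> V (\bigcup_j A j) = 0%E.
Proof.
move=> A0; apply/eqP; rewrite eq_le capacity_ge0 andbT.
apply/lee_addgt0Pr => r r0; rewrite add0e.
have half_gt0 j : 0 < r / 2 ^+ j.+1 by rewrite divr_gt0// exprn_gt0.
have /choice[xi xiP] j : exists xi, [/\ H xi, forall w, \1_(A j) w <= xi w &
    e xi <= r / 2 ^+ j.+1].
  have : (V (A j) < (r / 2 ^+ j.+1)%:E)%E by rewrite A0 lte_fin.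
  move=> /ereal_inf_lt[_ [xi [Hxi xiA] <-] xir]; exists xi; split=> //.
  by move: xir; rewrite (E_fine E_fin Hxi) lte_fin => /ltW.
apply: (@capacity_cover xi).
- by move=> k; have [] := xiP k.
- by move=> k w; have [_ h _] := xiP k; apply: le_trans (h w); rewrite indicE.
- move=> n; apply: (@le_trans _ _ (r - r / 2 ^+ n)); last first.
    by rewrite gerBl divr_ge0 ?exprn_ge0// ltW.
  elim: n => [|n IH]; first by rewrite big_ord0 expr0 divr1 subrr.
  rewrite big_ord_recr/=; have [_ _ h] := xiP n.
  have -> : r - r / 2 ^+ n.+1 = (r - r / 2 ^+ n) + r / 2 ^+ n.+1.
    by rewrite exprS; field; rewrite expf_neq0.
  exact: lerD.
- move=> w [j _ Ajw]; exists j; have [_ h _] := xiP j.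
  by apply: le_trans (h w); rewrite indicE mem_set.
Qed.

(** The tail after [N] covers [A], and [1/k^2 <= 1/(k-1) - 1/k] bounds its sum
    by [K/(N+1)]. *)
Lemma Borel_Cantelli (xi : nat -> Omega -> R) K (A : set Omega) :
  (forall n, H (xi n)) -> (forall n w, 0 <= xi n w) ->
  (forall n, e (xi n.+1) <= K / n.+1%:R ^+ 2) ->
  (forall w N, A w -> exists n, (N <= n)%N /\ 1 <= xi n w) -> V A = 0%E.
Proof.
move=> Hxi xi0 exi infA; apply/eqP; rewrite eq_le capacity_ge0 andbT.
have K0 : 0 <= K.
  have := exi 0%N; rewrite expr1n divr1; apply: le_trans.
  rewrite -(e_cst E_sublinear 0); apply: (e_le E_sublinear E_fin) => //.
  exact: rv_cst.
have VN N : (V A <= (K / N.+1%:R)%:E)%E.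
  apply: (@capacity_cover (fun k => xi (N.+1 + k).+1)) => //.
    move=> n.
    apply: (@le_trans _ _ (K / N.+1%:R - K / (N.+1 + n)%:R)); last first.
      by rewrite gerBl divr_ge0.
    elim: n => [|n IH]; first by rewrite big_ord0 addn0 subrr.
    rewrite big_ord_recr/= addnS; apply: (le_trans (lerD IH (exi _))).
    set m := (N.+1 + n)%N.
    have m0 : 0 < m%:R :> R by rewrite ltr0n.
    suff : K / m.+1%:R ^+ 2 <= K / m%:R - K / m.+1%:R.
      move: (K / m.+1%:R ^+ 2) (K / m%:R) (K / m.+1%:R) (K / N.+1%:R).
      by move=> *; lra.
    rewrite -mulrBr ler_wpM2l// -[m.+1%:R]natr1 -subr_ge0.
    rewrite (_ : _ - _ = (m%:R * (m%:R + 1) ^+ 2)^-1).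
      by rewrite invr_ge0 mulr_ge0 ?sqr_ge0// ltW.
    by field; rewrite !lt0r_neq0// addr_gt0.
  move=> w /(infA w N.+2)[n [Nn xin]]; exists (n - N.+2)%N.
  by rewrite -addSn subnKC.
apply/lee_addgt0Pr => r r0; rewrite add0e.
apply: (le_trans (VN (Num.bound (K / r)))).
rewrite lee_fin ler_pdivrMr// mulrC -ler_pdivrMr//.
have /archi_boundP/ltW/le_trans : 0 <= K / r by rewrite divr_ge0// ltW.
by apply; rewrite ler_nat.
Qed.

End continuity.
End capacity.

(** * The strong law of large numbers *)

(** The gap [1/(j+1)] is discrete so that the event on the left is covered by
    countably many events of the form on the right. *)
Lemma limn_esup_gt_frequently (R : realType) (u : nat -> R) (l : R) :
  (l%:E < limn_esup (fun n => (u n)%:E))%E ->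
  exists j : nat, forall N, exists n, (N <= n)%N /\ l + j.+1%:R^-1 <= u n.
Proof.
rewrite ltNge => /negP ul; apply: contrapT => /forallNP notj; apply: ul.
apply/lee_addgt0Pr => r r0.
have [j jr] : exists j : nat, l + j.+1%:R^-1 < l + r.
  by apply: ltr_add_invr; rewrite ltrDl.
have /existsNP[N /forallNP uN] := notj j.
rewrite -EFinD; apply: (@le_trans _ _ (l + j.+1%:R^-1)%:E); last exact: ltW.
apply: (@le_trans _ _ (ereal_sup [set (u n)%:E | n in [set n | (N <= n)%N]])).
  by apply: ereal_inf_lbound; exists [set n | (N <= n)%N] => //; exists N.
apply: ge_ereal_sup => _ [n /= Nn <-]; rewrite lee_fin leNgt; apply/negP => un.
by apply: (uN n); split=> //; exact: ltW.
Qed.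

Section upper_law.
Context {R : realType} {d : measure_display} {Omega : measurableType d}.
Context {H : set (Omega -> R)} {E : (Omega -> R) -> \bar R}.
Context {X : nat -> Omega -> R}.
Hypothesis H_space : rv_space H.
Hypothesis E_sublinear : sublinear_expectation H E.
Hypothesis E_fin : forall Z, H Z -> E Z \is a fin_num.
Hypothesis H_monotone : monotone_class H.
Hypothesis E_below : continuous_from_below H E.
Hypothesis X_in_H : forall n, (1 <= n)%N -> H (X n).
Hypothesis X_independent : independent_seq H E X.
Hypothesis X_identical : identically_distributed E X.

Local Notation V := (capacity H E).

(** The factor [c] is there to obtain both halves of the law, from [c = 1] and
    [c = -1]. *)
Lemma upper_law_of_large_numbers (c : R) :
  V [set w | (E (fun w => c * X 1%N w)%R <
    limn_esup (fun n => (c * (partial_sum X n w / n%:R))%:E))%E] = 0%E.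
Proof.
set mu := fine (E (fun w => c * X 1%N w)).
have HcX : H (fun w => c * X 1%N w) by apply: rvZ => //; exact: X_in_H.
rewrite (E_fine E_fin HcX) -/mu.
pose A j := [set w | forall N, exists n, (N <= n)%N /\
  mu + j.+1%:R^-1 <= c * (partial_sum X n w / n%:R)].
suff A0 j : V (A j) = 0%E.
  apply/eqP; rewrite eq_le capacity_ge0// andbT.
  rewrite -(capacity_bigcup_null H_space E_sublinear E_fin H_monotone E_below
    A0).
  apply: capacity_mono => w /= /limn_esup_gt_frequently[j wj].
  by exists j.
have [K mom] := fourth_moment H_space E_sublinear E_fin X_in_H X_independent
  X_identical c.
(* [xi n] is at least 1 as soon as [excess n >= n / (j+1)]: Markov's inequality
   for the fourth power. *)
pose xi n w := j.+1%:R ^+ 4 / n%:R ^+ 4 *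
  Num.max (excess (E := E) (X := X) c n w) 0 ^+ 4.
have Hpos n := H_pos_excess (E := E) H_space X_in_H c n 4.
have c0 n : 0 <= j.+1%:R ^+ 4 / n%:R ^+ 4 :> R by rewrite divr_ge0 ?exprn_ge0.
apply: (Borel_Cantelli H_space E_sublinear E_fin H_monotone E_below (xi := xi)
  (K := j.+1%:R ^+ 4 * K)).
- by move=> n; exact: rvZ.
- move=> n w; apply: mulr_ge0 => //; apply: exprn_ge0.
  by rewrite le_max lexx orbT.
- move=> n; rewrite (eZ E_sublinear E_fin)//.
  have n0 : 0 < n.+1%:R :> R by rewrite ltr0n.
  apply: (le_trans (ler_wpM2l (c0 _) (mom _))).
  by rewrite le_eqVlt; apply/orP; left; apply/eqP; field; rewrite lt0r_neq0.
- move=> w N /(_ N.+1)[n [Nn muS]]; exists n; split; first exact: ltnW.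
  have n0 : 0 < n%:R :> R by rewrite ltr0n (leq_trans _ Nn).
  have ex : n%:R / j.+1%:R <= excess (E := E) (X := X) c n w.
    rewrite excessE -/mu; move: muS; rewrite mulrA ler_pdivlMr//.
    by move: j.+1%:R^-1 (c * partial_sum _ _ _) n%:R => a b m; lra.
  rewrite /xi -exprVn -!exprMn; apply: exprn_ege1.
  apply: (@le_trans _ _ (j.+1%:R / n%:R * (n%:R / j.+1%:R))).
    by rewrite mulrA divfK ?divff ?lt0r_neq0// ltr0n.
  rewrite ler_wpM2l ?divr_ge0//; apply: le_trans ex _.
  by rewrite le_max lexx.
Qed.

End upper_law.

Local Open Scope ereal_scope.

Theorem corollary3p4 (R : realType) (d : measure_display)
    (Omega : measurableType d) (H : set (Omega -> R))
    (E : (Omega -> R) -> \bar R) (X : nat -> Omega -> R)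
    (H_space : rv_space H)
    (E_sublinear : sublinear_expectation H E)
    (H_monotone : monotone_class H)
    (E_continuous : continuous_expectation H E)
    (X_in_H : forall n, (1 <= n)%N -> H (X n))
    (X_independent : independent_seq H E X)
    (X_identical : identically_distributed E X) :
  let V := capacity H E in
  let S := partial_sum X in
  (V [set w | limn_esup (fun n => (`|S n w| / n%:R)%:E) = +oo] < 1 ->
     choquet V (fun w => `|X 1%N w|)%R < +oo) /\
  (choquet V (fun w => `|X 1%N w|)%R < +oo ->
     V ([set w | limn_einf (fun n => (S n w / n%:R)%:E)
                   < conjugate_expectation E (X 1%N)] `|`
        [set w | E (X 1%N) < limn_esup (fun n => (S n w / n%:R)%:E)]) = 0).
Proof.
move=> V S; have [E_fin E_below _] := E_continuous.
split=> _.
  exact: (choquet_lty H_space E_sublinear E_fin (X_in_H 1%N isT)).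
have upper := upper_law_of_large_numbers H_space E_sublinear E_fin H_monotone
  E_below X_in_H X_independent X_identical.
pose tail c := [set w | E (fun w => c * X 1%N w)%R <
  limn_esup (fun n => (c * (S n w / n%:R))%:E)].
(* The union of the two tails, as a countable union. *)
pose A (j : nat) := tail (if j == 0%N then (-1)%R else 1%R).
have A0 j : V (A j) = 0 by exact: upper.
apply/eqP; rewrite eq_le (capacity_ge0 H_space E_sublinear) andbT.
rewrite -(capacity_bigcup_null H_space E_sublinear E_fin H_monotone E_below A0).
apply: capacity_mono => w /= [|].
- move=> lo; exists 0%N => //; rewrite /A /tail /=.
  under eq_fun do rewrite mulN1r.
  under [X in limn_esup X]eq_fun do rewrite mulN1r.
  by move: lo; rewrite /limn_einf /conjugate_expectation lteN2.
- move=> hi; exists 1%N => //; rewrite /A /tail /=.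
  under eq_fun do rewrite mul1r.
  by under [X in limn_esup X]eq_fun do rewrite mul1r.
Qed.
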